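(* Let $n\in\{0,1,2,\dots\}$. Then for all $\delta\in(0,n+1)$, with $z=\ln\bigl(\frac{n+1}{\delta}\bigr)$, $$s_n(\delta)<z+(n+1-\delta)\,\ln z-(n+1)\,\frac{\partial\gamma}{\partial a}(1,z).$$
   Context: For $n\in\{0,1,2,\dots\}$ and $\delta\in(0,n+1)$, $s_n(\delta)$ denotes the unique positive solution $s$ of $$e^s=1+\frac{s^1}{1!}+\dots+\frac{s^n}{n!}+\frac{1}{\delta}\,\frac{s^{n+1}}{n!}.$$ Here $\gamma(a,z)=\int_0^z t^{a-1}e^{-t}\,dt$ ($a>0$, $z>0$) is the incomplete Gamma function, so that $$\frac{\partial\gamma}{\partial a}(1,z)=\int_0^z e^{-t}\ln t\,dt,\qquad z>0.$$ *)

(* Defs.v *)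
From HB Require Import structures.
From mathcomp Require Import all_boot all_order all_algebra.
From mathcomp Require Import all_classical all_reals all_analysis.
From mathcomp Require Import ring lra.

Set Implicit Arguments.
Unset Strict Implicit.
Unset Printing Implicit Defensive.

Import Order.TTheory GRing.Theory Num.Theory.
Import numFieldNormedType.Exports.

Local Open Scope classical_set_scope.
Local Open Scope ring_scope.

Definition s_eqn (R : realType) (n : nat) (delta s : R) : Prop :=
  expR s = \sum_(k < n.+1) s ^+ k / k`!%:R
           + delta^-1 * (s ^+ n.+1 / n`!%:R).

(* Total by choice; for 0 < delta < n + 1 it is the unique positive solution,
   see [s_nP] and [s_n_unique]. *)
Definition s_n (R : realType) (n : nat) (delta : R) : R :=
  get [set s : R | 0 < s /\ s_eqn n delta s].

(* A Lebesgue integral, so the singularity of the integrand at 0 for a < 1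
   needs no improper-integral treatment. *)
Definition gamma_inc (R : realType) (a z : R) : R :=
  \int[@lebesgue_measure R]_(t in `]0, z]) (t `^ (a - 1) * expR (- t)).

Definition dgamma_inc (R : realType) (a z : R) : R :=
  derive1 (fun b : R => gamma_inc b z) a.

Section solution.
Variable R : realType.
Implicit Types (c x y s r delta : R) (f g : R -> R) (m n : nat).

Let G m x : R := \sum_(k < m) x ^+ k / k`!%:R.
Let P m x : R := x ^+ m / m`!%:R.
Let F m c x : R := expR x - G m x - c * P m x.

Let is_deriveP m x : is_derive x 1 (P m.+1) (P m x).
Proof.
have -> : P m.+1 = m.+1`!%:R^-1 \*: (@id R ^+ m.+1).
  by apply/funext => y; rewrite /P mulrC fctE.
apply: is_derive_eq; rewrite /P factS natrM /GRing.scale /= mulr1.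
have h : m.+1%:R != 0 :> R by rewrite pnatr_eq0.
have h' : m`!%:R != 0 :> R by rewrite pnatr_eq0 -lt0n fact_gt0.
by field; rewrite h' nat1r h.
Qed.

Let is_deriveG m x : is_derive x 1 (G m.+1) (G m x).
Proof.
elim: m => [|m IH].
  have -> : G 1 = cst 1.
    by apply/funext => y; rewrite /G big_ord1 expr0 fact0 divr1.
  by rewrite /G big_ord0; exact: is_derive_cst.
have -> : G m.+2 = G m.+1 + P m.+1.
  by apply/funext => y; rewrite /G big_ord_recr.
have -> : G m.+1 x = G m x + P m x by rewrite /G big_ord_recr.
exact: is_deriveD.
Qed.

Let is_deriveF m c x : is_derive x 1 (F m.+1 c) (F m c x).
Proof.
have -> : F m.+1 c = expR - G m.+1 - c \*: P m.+1 by [].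
exact: (is_deriveB (is_deriveB (is_derive_expR x) (is_deriveG m x))
  (is_deriveZ c (is_deriveP m x))).
Qed.

Let crosses f := exists2 r, 0 < r &
  [/\ f r = 0, forall x, 0 < x < r -> f x < 0,
      forall x, r < x -> 0 < f x
    & forall x y, r <= x -> x <= y -> f x <= f y].

Let crosses_primitive f g : (forall x, is_derive x 1 f (g x)) ->
  f 0 = 0 -> crosses g -> crosses f.
Proof.
move=> fg f0 [r r0 [gr gneg gpos gincr]].
have cf a b : {within `[a, b], continuous f}.
  by apply: derivable_within_continuous => x _; exact: ex_derive.
have mvt a b : a < b -> exists2 d, a < d < b & f b - f a = g d * (b - a).
  move=> ab; have [d + ->] := MVT ab (fun x _ => fg x) (@cf a b).
  by rewrite in_itv /=; exists d.
have fneg x : 0 < x <= r -> f x < 0.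
  move=> /andP[x0 xr]; have [d /andP[d0 dx]] := mvt _ _ x0.
  rewrite f0 !subr0 => ->; rewrite pmulr_llt0//; apply: gneg.
  by rewrite d0 (lt_le_trans dx).
have fincr x y : r <= x -> x < y -> f x < f y.
  move=> rx xy; have [d /andP[xd dy] e] := mvt _ _ xy.
  by rewrite -subr_gt0 e mulr_gt0 ?subr_gt0// gpos// (le_lt_trans rx).
have [b rb fb] : exists2 b, r < b & 0 < f b.
  have g1 : 0 < g (r + 1) by rewrite gpos// ltrDl.
  pose K := `|f (r + 1)| / g (r + 1) + 1.
  have K0 : 0 < K by rewrite ltr_wpDl// divr_ge0// ltW.
  exists (r + 1 + K); first by rewrite -addrA ltrDl addr_gt0.
  have lt1 : r + 1 < r + 1 + K by rewrite ltrDl.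
  have [d /andP[d1 _]] := mvt _ _ lt1.
  rewrite [X in _ * X]addrC addKr => e.
  have : g (r + 1) * K <= g d * K.
    by rewrite ler_wpM2r ?(ltW K0)// gincr ?(ltW d1)// lerDl.
  have -> : g (r + 1) * K = `|f (r + 1)| + g (r + 1).
    by rewrite /K mulrDr mulr1 mulrCA divff ?mulr1// gt_eqF.
  have := ler_norm (- f (r + 1)); rewrite normrN => hn.
  by rewrite -e; lra.
have fr : f r < 0 by rewrite fneg// r0 lexx.
have [q] : exists2 q, q \in `[r, b] & f q = 0.
  apply: IVT => //; first exact: ltW.
  by rewrite ge_min le_max (ltW fr) (ltW fb) orbT.
rewrite in_itv /= => /andP[rq qb] fq.
have rq' : r < q.
  by rewrite lt_neqAle rq andbT; apply: contraTneq fr => ->; rewrite fq ltxx.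
exists q; first exact: lt_trans rq'.
split=> //.
- move=> x /andP[x0 xq]; have [xr|rx] := leP x r; first by rewrite fneg// x0.
  by rewrite -fq fincr// ltW.
- by move=> x qx; rewrite -fq fincr.
- move=> x y qx; rewrite le_eqVlt => /predU1P[->//|xy].
  by rewrite ltW// fincr// (le_trans rq).
Qed.

Let crossesF m c : 1 < c -> crosses (F m c).
Proof.
move=> c1; elim: m => [|m IH].
  have c0 : 0 < c := lt_trans ltr01 c1.
  have FE x : F 0 c x = expR x - c.
    by rewrite /F /G /P big_ord0 expr0 fact0 divr1 mulr1 subr0.
  exists (ln c); first exact: ln_gt0.
  split=> [|x|x|x y]; rewrite !FE.
  - by rewrite lnK ?subrr// posrE.
  - by move=> /andP[_ xc]; rewrite subr_lt0 -[ltRHS]lnK ?posrE// ltr_expR.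
  - by move=> xc; rewrite subr_gt0 -[ltLHS]lnK ?posrE// ltr_expR.
  - by move=> _ xy; rewrite lerB// ler_expR.
apply: (crosses_primitive (@is_deriveF m c)) IH.
rewrite /F /G /P big_ord_recl big1 ?expr0 ?fact0 ?expr0n /=.
  by rewrite expR0 mul0r mulr0 divr1 addr0 !subr0 subrr.
by move=> i _; rewrite expr0n /= mul0r.
Qed.

Let s_eqnF n delta s : 0 < delta ->
  s_eqn n delta s <-> F n.+1 (n.+1%:R / delta) s = 0.
Proof.
move=> d0; rewrite /s_eqn /F /G /P.
have -> : n.+1%:R / delta * (s ^+ n.+1 / n.+1`!%:R)
          = delta^-1 * (s ^+ n.+1 / n`!%:R).
  have h : n.+1%:R != 0 :> R by rewrite pnatr_eq0.
  have h' : n`!%:R != 0 :> R by rewrite pnatr_eq0 -lt0n fact_gt0.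
  by rewrite factS natrM; field; rewrite h' nat1r h gt_eqF.
by split=> [->|/eqP]; [ring | rewrite -addrA -opprD subr_eq0 => /eqP].
Qed.

Lemma s_eqn_exists_unique n delta : 0 < delta < n.+1%:R ->
  exists! s, 0 < s /\ s_eqn n delta s.
Proof.
move=> /andP[d0 dn].
have [|r r0 [fr fneg fpos _]] := @crossesF n.+1 (n.+1%:R / delta).
  by rewrite ltr_pdivlMr// mul1r.
exists r; split; first by split=> //; apply/s_eqnF.
move=> s [s0 /(s_eqnF _ _ d0) fs]; apply/eqP; case: ltgtP => // [rs|sr].
  by have := fpos _ rs; rewrite fs ltxx.
by have := fneg s; rewrite s0 sr fs ltxx => /(_ isT).
Qed.

Lemma s_nP n delta : 0 < delta < n.+1%:R ->
  0 < s_n n delta /\ s_eqn n delta (s_n n delta).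
Proof.
move=> /s_eqn_exists_unique[s [hs _]].
exact: (@getPex _ [set s : R | 0 < s /\ s_eqn n delta s] (ex_intro _ s hs)).
Qed.

Lemma s_n_unique n delta s : 0 < delta < n.+1%:R ->
  0 < s -> s_eqn n delta s -> s = s_n n delta.
Proof.
move=> hd s0 hs; have [r [_ ru]] := s_eqn_exists_unique hd.
by rewrite -(ru s) -?(ru _ (s_nP hd)).
Qed.

End solution.

(* Main.v *)
Require Import Defs.
From mathcomp Require Import all_boot all_order all_algebra.
From mathcomp Require Import all_classical all_reals all_analysis.
From mathcomp Require Import measurable_realfun ring lra.

(** Put [N = n + 1], [s = s_n delta] and [z = ln (N / delta)], so that
[delta = N e^-z].  As the integral of [e^-t] over ]0, z] is [1 - e^-z], the
claimed bound equals [z + N Ein(z)], where [Ein(z)] is the integral over ]0, z]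
of [e^-t (ln z - ln t)], or of [(1 - e^-t) / t] after integration by parts.

Let [phi(s)] be [N! / s^N] times the tail of the exponential series from degree
[N] on ([tail_ratio]).  The equation for [s] says [phi(s) = N / delta], hence
[z = ln (phi(s))], and letting [delta] vary makes [z] a function of [s > 0].
With [q = 1 - 1 / phi = 1 - e^-z] one finds [z' = (s - N q) / s]
([is_derive_ln_tail_ratio]) and [Ein'(z) = q / z] ([is_derive_Ein]), so that
[[
  d/ds (z + N Ein(z) - s) = N q (s - z - N q) / (s z).
]]
This is positive because [z + N q < s] ([ln_tail_ratio_lt]), which amounts to
[z < s z'] and thus to the convexity of the logarithm of the moment generating
function [phi].  It is proved as Jensen's inequality for [u ln u], with the
[N]-fold primitive vanishing at 0 as the positive functional
([exp_tail_entropy_gt0]).  Since [z] and [Ein(z)] are nonnegative, the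
increasing function [z + N Ein(z) - s] is at least [- s], so it is positive for
all [s > 0] ([lt_Ein_ln_tail_ratio]).

It remains that the derivative of the incomplete Gamma function at [a = 1] is
the integral of [e^-t ln t] ([dgamma_incE]): this is differentiation under the
integral sign, where the domination near 0 comes from the integrability of
powers with exponent above -1 ([integrable_powR]). *)

Import Order.TTheory GRing.Theory Num.Theory.
Import numFieldNormedType.Exports.

Local Open Scope ring_scope.

Section exponential_tails_and_incomplete_gamma.
#[local] Set Implicit Arguments.
#[local] Unset Strict Implicit.
Local Open Scope classical_set_scope.
Local Open Scope ring_scope.

Variable R : realType.
Implicit Types (f g : R -> R) (a b c p q r x y z t : R) (k n : nat).
Local Notation mu := (@lebesgue_measure R).

(** * Tails of the exponential series *)

Lemma is_derive_mean f g a b : a < b ->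
  (forall x, a <= x <= b -> is_derive x 1 f (g x)) ->
  exists2 c, a < c < b & f b - f a = g c * (b - a).
Proof.
move=> ab fg.
have cf : {within `[a, b], continuous f}.
  apply: derivable_within_continuous => x; rewrite in_itv /= => xab.
  by case: (fg x xab).
have [|c + ->] := @MVT R f g a b ab _ cf.
  move=> x; rewrite in_itv /= => /andP[ax xb].
  by apply: fg; rewrite !ltW.
by rewrite in_itv /=; exists c.
Qed.

(** Strictness is asked of [g] on an initial interval only: the function to
which this is first applied, a tangent-line gap, vanishes at [z]. *)
Lemma primitive_gt0 f g z : 0 < z -> (forall x, is_derive x 1 f (g x)) ->
  f 0 = 0 -> (forall x, 0 < x < z -> 0 < g x) ->
  (forall x, 0 < x -> 0 <= g x) -> forall x, 0 < x -> 0 < f x.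
Proof.
move=> z0 fg f0 gpos gge0.
have fpos x : 0 < x <= z -> 0 < f x.
  move=> /andP[x0 xz].
  have [c /andP[c0 cx]] := @is_derive_mean f g 0 x x0 (fun x _ => fg x).
  rewrite f0 !subr0 => ->; rewrite mulr_gt0// gpos// c0/=.
  exact: lt_le_trans xz.
move=> x x0; have [xz|zx] := leP x z; first by rewrite fpos// x0.
have [c /andP[zc cx] e] := @is_derive_mean f g z x zx (fun x _ => fg x).
rewrite (lt_le_trans (fpos z _))// ?z0 ?lexx//.
by rewrite -subr_ge0 e mulr_ge0 ?gge0 ?(lt_trans z0)// subr_ge0 ltW.
Qed.

Definition monomial k x : R := x ^+ k / k`!%:R.

Definition exp_tail k x : R := expR x - \sum_(i < k) monomial i x.

Lemma monomial_gt0 k x : 0 < x -> 0 < monomial k x.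
Proof. by move=> x0; rewrite divr_gt0 ?exprn_gt0// ltr0n fact_gt0. Qed.

Lemma monomialS k x : k.+1%:R * monomial k.+1 x = x * monomial k x.
Proof.
have h : k.+1%:R != 0 :> R by rewrite pnatr_eq0.
have h' : k`!%:R != 0 :> R by rewrite pnatr_eq0 -lt0n fact_gt0.
by rewrite /monomial factS natrM exprS; field; rewrite h' nat1r h.
Qed.

Lemma exp_tailS k x : exp_tail k.+1 x = exp_tail k x - monomial k x.
Proof. by rewrite /exp_tail big_ord_recr /= opprD addrA. Qed.

Lemma is_derive_monomial k x :
  is_derive x 1 (monomial k.+1) (monomial k x).
Proof.
have -> : monomial k.+1 = k.+1`!%:R^-1 \*: (@id R ^+ k.+1).
  by apply/funext => y; rewrite /monomial mulrC fctE.
apply: is_derive_eq; rewrite /monomial factS natrM /GRing.scale /= mulr1.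
have h : k.+1%:R != 0 :> R by rewrite pnatr_eq0.
have h' : k`!%:R != 0 :> R by rewrite pnatr_eq0 -lt0n fact_gt0.
by field; rewrite h' nat1r h.
Qed.

(** Differentiation lowers the index, so [exp_tail k] is the [k]-fold primitive
of the exponential that vanishes to order [k] at 0; likewise [monomial k] is
that of 1. *)
Lemma is_derive_exp_tail k x :
  is_derive x 1 (exp_tail k.+1) (exp_tail k x).
Proof.
elim: k x => [|k IH] x.
  have -> : exp_tail 1 = expR - cst 1.
    apply/funext => y.
    by rewrite /exp_tail big_ord1 /monomial expr0 fact0 divr1.
  have -> : exp_tail 0 x = expR x - 0 by rewrite /exp_tail big_ord0.
  exact: is_deriveB.
have -> : exp_tail k.+2 = exp_tail k.+1 - monomial k.+1.
  by apply/funext => y; rewrite exp_tailS.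
by rewrite exp_tailS; apply: is_deriveB; exact: is_derive_monomial.
Qed.

Lemma monomial0 k : monomial k.+1 0 = 0.
Proof. by rewrite /monomial expr0n /= mul0r. Qed.

Lemma exp_tail0 k : exp_tail k.+1 0 = 0.
Proof.
rewrite /exp_tail big_ord_recl big1 => [|i _]; last exact: monomial0.
by rewrite /monomial expR0 expr0 fact0 divr1 addr0 subrr.
Qed.

Lemma exp_tail_gt0 k x : 0 < x -> 0 < exp_tail k x.
Proof.
elim: k x => [|k IH] x x0; first by rewrite /exp_tail big_ord0 subr0 expR_gt0.
apply: (primitive_gt0 (z := 1)) (is_derive_exp_tail k) _ _ _ _ x0 => //.
- exact: exp_tail0.
- by move=> y /andP[y0 _]; exact: IH.
- by move=> y y0; exact/ltW/IH.
Qed.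

(** This is Jensen's inequality for [u ln u] under the [k.+1]-fold primitive,
a positive functional.  The tangent line of [u ln u] at [u = e^z], evaluated at
[u = e^y], gives [y e^y - (z + 1) e^y + e^z >= 0]; the left-hand side below is
the [k.+1]-fold primitive of this gap, because that of [y e^y] is
[y * exp_tail k.+1 y - k.+1 * exp_tail k.+2 y]. *)
Lemma exp_tail_entropy_gt0 k z x : 0 < z -> 0 < x ->
  0 < x * exp_tail k.+1 x - k.+1%:R * exp_tail k.+2 x
      - (z + 1) * exp_tail k.+1 x + expR z * monomial k.+1 x.
Proof.
move=> z0.
pose W j y := y * exp_tail j y - j%:R * exp_tail j.+1 y
      - (z + 1) * exp_tail j y + expR z * monomial j y.
have dW j y : is_derive y 1 (W j.+1) (W j y).
  have -> : W j.+1 = id * exp_tail j.+1 - j.+1%:R \*: exp_tail j.+2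
      - (z + 1) \*: exp_tail j.+1 + expR z \*: monomial j.+1 by [].
  have dT := is_derive_exp_tail j y.
  have dT' := is_derive_exp_tail j.+1 y.
  have dP := is_derive_monomial j y.
  apply: is_derive_eq; rewrite /W /GRing.scale /= -natr1; ring.
have W0 j : W j.+1 0 = 0.
  by rewrite /W !exp_tail0 monomial0 !mulr0 !subr0 addr0.
have W0E y : W 0 y = expR y * (expR (z - y) - (1 + (z - y))).
  rewrite /W /exp_tail !big_ord0 /monomial expr0 fact0 divr1 mul0r.
  by rewrite expRD expRN; field; rewrite gt_eqF ?expR_gt0.
elim: k x => [|k IH] x x0.
  apply: (primitive_gt0 z0 (dW 0)) x0 => //.
  - move=> y /andP[y0 yz]; rewrite W0E mulr_gt0 ?expR_gt0// subr_gt0.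
    by rewrite expR_gt1Dx// subr_eq0 gt_eqF.
  - move=> y y0; rewrite W0E mulr_ge0 ?expR_ge0// subr_ge0.
    exact: expR_ge1Dx.
apply: (primitive_gt0 z0 (dW k.+1)) x0 => //.
- by move=> y /andP[y0 _]; exact: IH.
- by move=> y y0; exact/ltW/IH.
Qed.

(** The equation defining [s_n] says [tail_ratio n.+1 s = n.+1 / delta].  This
ratio is also the moment generating function of the Beta(1, k) law
if [k > 0]. *)
Definition tail_ratio k x : R := exp_tail k x / monomial k x.

Lemma tail_ratio_gt1 k x : 0 < x -> 1 < tail_ratio k x.
Proof.
move=> x0; rewrite ltr_pdivlMr ?monomial_gt0// mul1r -subr_gt0 -exp_tailS.
exact: exp_tail_gt0.
Qed.

(** With [m = tail_ratio k.+1 x] and [z = ln m], the two tails in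
[exp_tail_entropy_gt0] are [m] and [m - 1] times the same monomial, and dividing
by it leaves the claim.  It expresses the convexity of [z] in [x]: by the next
lemma, it reads [z < x z']. *)
Lemma ln_tail_ratio_lt k x : 0 < x ->
  ln (tail_ratio k.+1 x) + k.+1%:R * (1 - (tail_ratio k.+1 x)^-1) < x.
Proof.
move=> x0; have m1 := tail_ratio_gt1 k.+1 x0.
have := exp_tail_entropy_gt0 k (ln_gt0 m1) x0.
have m0 : 0 < tail_ratio k.+1 x := lt_trans ltr01 m1.
have P0 := monomial_gt0 k.+1 x0.
rewrite (exp_tailS k.+1) lnK ?posrE//.
have -> : exp_tail k.+1 x = tail_ratio k.+1 x * monomial k.+1 x.
  by rewrite divfK// gt_eqF.
move: (tail_ratio k.+1 x) m0 {m1} (monomial k.+1 x) P0 => m m0 P P0.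
set N := k.+1%:R; set l := ln m => h.
have : 0 < m * P * (x - (l + N * (1 - m^-1))).
  by move: h; congr (is_true (0 < _)); field; rewrite gt_eqF.
by rewrite pmulr_rgt0 ?subr_gt0// mulr_gt0.
Qed.

Lemma is_derive_ln_tail_ratio k x : 0 < x ->
  is_derive x 1 (fun y => ln (tail_ratio k.+1 y))
    ((x - k.+1%:R * (1 - (tail_ratio k.+1 x)^-1)) / x).
Proof.
move=> x0; have m0 := lt_trans ltr01 (tail_ratio_gt1 k.+1 x0).
have P0 := monomial_gt0 k.+1 x0.
have dT := is_derive_exp_tail k x.
have dP := is_derive_monomial k x.
have dV : is_derive x 1 (fun y => (monomial k.+1 y)^-1)
    (- monomial k.+1 x ^- 2 *: monomial k x).
  by apply: is_deriveV => //; rewrite gt_eqF.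
have dl := is_derive1_ln m0.
have dm := is_deriveM dT dV.
have -> : (fun y => ln (tail_ratio k.+1 y)) =
    @ln R \o (exp_tail k.+1 * (fun y => (monomial k.+1 y)^-1)) by [].
have dc := is_derive1_comp (dl : is_derive
  ((exp_tail k.+1 * (fun y => (monomial k.+1 y)^-1)) x) 1 (@ln R) _) dm.
apply: (is_derive_eq dc).
rewrite /GRing.scale /=.
have T0 := exp_tail_gt0 k.+1 x0.
have -> : exp_tail k x = exp_tail k.+1 x + monomial k x.
  by rewrite exp_tailS subrK.
have -> : monomial k x = k.+1%:R * monomial k.+1 x / x.
  by rewrite monomialS mulrAC divff ?mul1r// gt_eqF.
rewrite /tail_ratio.
field.
by rewrite !gt_eqF.
Qed.

(** * Integrability of powers at 0 *)

Lemma integral_powR_itvcc p a z : 0 < a -> a < z -> p + 1 != 0 ->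
  (\int[mu]_(t in `[a, z]) (t `^ p)%:E
   = (z `^ (p + 1) / (p + 1) - a `^ (p + 1) / (p + 1))%:E)%E.
Proof.
move=> a0 az p1; pose F t := t `^ (p + 1) / (p + 1).
have dF t : 0 < t -> is_derive t 1 F (t `^ p).
  move=> t0; have -> : F = (p + 1)^-1 \*: (@powR R ^~ (p + 1)).
    by apply/funext => y; rewrite /F mulrC.
  have dp := is_derive1_powR (p + 1) t0.
  by apply: is_derive_eq; rewrite addrK /GRing.scale /= mulKf.
have az0 t : t \in `[a, z] -> 0 < t.
  by rewrite in_itv /= => /andP[/(lt_le_trans a0)].
rewrite (@continuous_FTC2 _ _ F _ _ az)//.
- apply: derivable_within_continuous => t /az0 t0.
  by case: (is_derive1_powR p t0).
- have : {within `[a, z], continuous F}.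
    apply: derivable_within_continuous => t /az0 t0.
    by case: (dF t t0).
  move=> /(continuous_within_itvP _ az)[_ Fa Fz]; split => // t.
  rewrite in_itv /= => /andP[at_ _].
  by case: (dF t (lt_trans a0 at_)).
- move=> t; rewrite in_itv /= => /andP[at_ _].
  have := dF t (lt_trans a0 at_); rewrite derive1E => dFt.
  exact: derive_val.
Qed.

(** For [p < 0] the integrand is unbounded at 0, so the primitive is used
between [1 / (n + 1)] and [z], and the bound passes to the limit by monotone
convergence. *)
Lemma integrable_powR p z : -1 < p ->
  mu.-integrable `]0, z] (EFin \o (@powR R ^~ p)).
Proof.
move=> p1.
have q0 : 0 < p + 1 by rewrite -ltrBlDr sub0r.
have mf (D : set R) : measurable_fun D (@powR R ^~ p).
  by apply: measurable_funTS; exact: measurable_powR.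
apply/integrableP; split; first (apply/measurable_EFinP; exact: mf).
have -> : (\int[mu]_(t in `]0%R, z]) `|(EFin \o (@powR R ^~ p)) t|
    = \int[mu]_(t in `]0%R, z]) (t `^ p)%:E)%E.
  by apply: eq_integral => t _ /=; rewrite ger0_norm// powR_ge0.
have -> : `]0, z]%classic = \bigcup_n `[n.+1%:R^-1, z]%classic.
  apply/seteqP; split=> t /=; rewrite in_itv /=.
    move=> /andP[t0 tz]; exists (Num.truncn t^-1) => //=.
    rewrite in_itv /= tz andbT invf_ple ?posrE//.
    by rewrite ltW// Num.Theory.truncnS_gt.
  move=> [n _ /=]; rewrite in_itv /= => /andP[nt ->]; rewrite andbT.
  by rewrite (lt_le_trans _ nt)// invr_gt0.
apply: (@le_lt_trans _ _ (z `^ (p + 1) / (p + 1))%:E); last exact: ltry.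
apply: (cvge_le _ (ge0_nondecreasing_set_cvg_integral _ _ _ _)) => //.
- apply: nearW => n; have [nz|zn] := ltP n.+1%:R^-1 z.
    rewrite integral_powR_itvcc ?gt_eqF// lee_fin gerBl//.
    by rewrite divr_ge0 ?powR_ge0 ?ltW.
  have := zn; rewrite le_eqVlt => /predU1P[->|zn'].
    by rewrite set_itv1 integral_set1 lee_fin divr_ge0 ?powR_ge0 ?ltW.
  rewrite set_itv_ge ?bnd_simp -?ltNge// integral_set0.
  by rewrite lee_fin divr_ge0 ?powR_ge0 ?ltW.
- move=> m n mn; rewrite subsetEset; apply: subset_itvr; rewrite bnd_simp.
  by rewrite lef_pV2 ?posrE// ler_nat ltnS.
- by move=> n; (apply/measurable_EFinP; exact: mf).
- by move=> n t _; rewrite lee_fin powR_ge0.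
Qed.

(** * The derivative of the incomplete Gamma function *)

(** The power [t `^ r] is monotone in [r], in a direction that depends on
whether [t <= 1]; the sum bounds it in both cases. *)
Lemma powR_le_add p q r t : 0 < t -> p <= r <= q -> t `^ r <= t `^ p + t `^ q.
Proof.
move=> t0 /andP[pr rq]; have [t1|t1] := leP t 1.
  by rewrite ler_wpDr ?powR_ge0// ger_powR// t0.
by rewrite ler_wpDl ?powR_ge0// ler_powR// ltW.
Qed.

Lemma normr_ln_le c t : 0 < c -> 0 < t ->
  `|ln t| <= c^-1 * (t `^ c + t `^ (- c)).
Proof.
move=> c0 t0; rewrite ler_pdivlMl// -[X in X * _]gtr0_norm// -normrM.
have E d : t `^ d = expR (d * ln t) by rewrite /powR gt_eqF.
have h d : d * ln t <= t `^ d.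
  by rewrite E (le_trans _ (expR_ge1Dx _))// lerDr.
rewrite ler_norml; have := h c; have := h (- c).
by have := powR_ge0 t c; have := powR_ge0 t (- c); lra.
Qed.

Lemma normr_ln_powR_le c p q r t : 0 < c -> 0 < t -> p <= r - c -> r + c <= q ->
  `|ln t * t `^ r| <= 2 / c * (t `^ p + t `^ q).
Proof.
move=> c0 t0 pr rq; rewrite normrM (ger0_norm (powR_ge0 _ _)).
apply: (le_trans (ler_wpM2r (powR_ge0 _ _) (normr_ln_le c0 t0))).
have tM d : t `^ d * t `^ r = t `^ (d + r).
  by rewrite powRD// (gt_eqF t0) implybT.
have -> : c^-1 * (t `^ c + t `^ (- c)) * t `^ r
    = c^-1 * (t `^ (c + r) + t `^ (- c + r)) by rewrite -!tM; ring.
rewrite [2 / c]mulrC -mulrA ler_pM2l ?invr_gt0//.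
have h1 : t `^ (c + r) <= t `^ p + t `^ q by apply: powR_le_add => //; lra.
have h2 : t `^ (- c + r) <= t `^ p + t `^ q by apply: powR_le_add => //; lra.
lra.
Qed.

Definition gamma_integrand a t : R := t `^ (a - 1) * expR (- t).

Lemma measurable_gamma_integrand a (D : set R) :
  measurable_fun D (gamma_integrand a).
Proof.
apply: measurable_funTS; apply: measurable_funM; first exact: measurable_powR.
by apply: measurableT_comp.
Qed.

Lemma integrable_gamma_integrand a z : 0 < a ->
  mu.-integrable `]0, z] (EFin \o gamma_integrand a).
Proof.
move=> a0; apply: le_integrable (@integrable_powR (a - 1) z _) => //.
- by apply/measurable_EFinP; exact: measurable_gamma_integrand.
- move=> t /=; rewrite in_itv /= => /andP[t0 _]; rewrite lee_fin.
  rewrite /gamma_integrand normrM [`|expR _|]ger0_norm ?expR_ge0//.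
  by rewrite ler_piMr// -expR0 ler_expR oppr_le0 ltW.
- by rewrite ltrBrDr addrC subrr.
Qed.

(** Dominates [ln t * gamma_integrand x t] uniformly for [x] in the interval
]a/2, 3a/2[.  The logarithm costs an exponent [a/4] on either side, so the
exponents, between [a/2 - 1] and [3a/2 - 1], spread to those between [a/4 - 1]
and [7a/4 - 1], still above -1. *)
Definition ln_gamma_majorant a t : R :=
  2 / (a / 4) * (t `^ (a / 4 - 1) + t `^ (7 * a / 4 - 1)).

Lemma normr_ln_gamma_integrand_le a x t : 0 < a -> a / 2 < x < 3 * a / 2 ->
  0 < t -> `|ln t * gamma_integrand x t| <= ln_gamma_majorant a t.
Proof.
move=> a0 /andP[ax xa] t0; rewrite /gamma_integrand mulrA normrM.
apply: (@le_trans _ _ `|ln t * t `^ (x - 1)|).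
  by rewrite ler_piMr// ger0_norm ?expR_ge0// -expR0 ler_expR oppr_le0 ltW.
by apply: normr_ln_powR_le => //; lra.
Qed.

Lemma integrable_ln_gamma_majorant a z : 0 < a ->
  mu.-integrable `]0, z] (EFin \o ln_gamma_majorant a).
Proof.
move=> a0; pose f p := EFin \o (@powR R ^~ p).
have -> : EFin \o ln_gamma_majorant a =
    (fun t => (2 / (a / 4))%R%:E *
      (f (a / 4 - 1)%R \+ f (7 * a / 4 - 1)%R) t)%E.
  by [].
by apply: integrableZl => //; apply: integrableD => //; apply: integrable_powR;
  lra.
Qed.

Lemma integrable_ln_gamma_integrand a z : 0 < a ->
  mu.-integrable `]0, z] (EFin \o (fun t => ln t * gamma_integrand a t)).
Proof.
move=> a0; apply: le_integrable (integrable_ln_gamma_majorant z a0) => //.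
- apply/measurable_EFinP; apply: measurable_funM; last first.
    exact: measurable_gamma_integrand.
  by apply: measurable_funTS; exact: measurable_ln.
- move=> t /=; rewrite in_itv /= => /andP[t0 _]; rewrite lee_fin.
  rewrite (le_trans (normr_ln_gamma_integrand_le a0 _ t0))//; last first.
    exact: ler_norm.
  by apply/andP; split; lra.
Qed.

(** Differentiation under the integral sign, with [ln_gamma_majorant] as the
dominating function. *)
Lemma dgamma_incE a z : 0 < a ->
  dgamma_inc a z = \int[mu]_(t in `]0, z]) (ln t * gamma_integrand a t).
Proof.
move=> a0.
have dg x t : 0 < t ->
    is_derive x 1 (fun y => gamma_integrand y t) (ln t * gamma_integrand x t).
  move=> t0; have E y : gamma_integrand y t = expR ((y - 1) * ln t - t).
    by rewrite /gamma_integrand /powR gt_eqF// -expRD.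
  have -> : (fun y => gamma_integrand y t)
      = @expR R \o (ln t \*: (@id R - cst 1) - cst t).
    by apply/funext => y; rewrite E /= /GRing.scale /= mulrC.
  have d1 : is_derive x 1 (ln t \*: (@id R - cst 1) - cst t) (ln t).
    by apply: is_derive_eq; rewrite !subr0 /GRing.scale /= mulr1.
  have := is_derive1_comp (is_derive_expR _) d1.
  rewrite E mulrC; congr (is_derive _ _ _ (_ * expR _)).
  by rewrite /= !fctE /= /GRing.scale /= mulrC.
rewrite /dgamma_inc /gamma_inc.
rewrite [LHS](@differentiation_under_integral R _ _ mu gamma_integrand
  `]0, z]%classic _ a (a / 2) (3 * a / 2) _ _ _ (ln_gamma_majorant a)) //=.
- apply: eq_Rintegral => t; rewrite inE /= in_itv /= => /andP[t0 _].
  have [_ ] := dg a t t0; by rewrite partial1of2E.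
- by rewrite in_itv /=; apply/andP; split; lra.
- move=> x; rewrite in_itv /= => /andP[ax _].
  by apply: integrable_gamma_integrand; lra.
- move=> x t _; rewrite in_itv /= => /andP[t0 _].
  by case: (dg x t t0).
- by move=> t; rewrite mulr_ge0 ?addr_ge0 ?powR_ge0// divr_ge0//; lra.
- exact: integrable_ln_gamma_majorant.
- move=> x t; rewrite !in_itv /= => xa /andP[t0 _].
  rewrite partial1of2E; have [_ ->] := dg x t t0.
  exact: normr_ln_gamma_integrand_le.
Qed.

Definition ln_expRN_integral z : R :=
  \int[mu]_(t in `]0, z]) (ln t * expR (- t)).

Lemma gamma_integrand1 : gamma_integrand 1 = (fun t => expR (- t)).
Proof.
by apply/funext => t; rewrite /gamma_integrand subrr powRr0 mul1r.
Qed.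

Lemma integrable_expRN z :
  mu.-integrable `]0, z] (EFin \o (fun t => expR (- t))).
Proof. by rewrite -gamma_integrand1; exact: integrable_gamma_integrand. Qed.

Lemma integrable_ln_expR z :
  mu.-integrable `]0, z] (EFin \o (fun t => ln t * expR (- t))).
Proof.
have := integrable_ln_gamma_integrand z (@ltr01 R).
by rewrite gamma_integrand1.
Qed.

Lemma dgamma_inc1E z : dgamma_inc 1 z = ln_expRN_integral z.
Proof. by rewrite dgamma_incE// gamma_integrand1. Qed.

(** * The entire exponential integral *)

(** Integration by parts turns this into the integral of [(1 - e^-t) / t] over
]0, z], the entire exponential integral; the form chosen here is the one in
which it occurs in the bound. *)
Definition Ein z : R := (1 - expR (- z)) * ln z - ln_expRN_integral z.

Lemma is_derive_expRN z : is_derive z 1 (fun y => expR (- y)) (- expR (- z)).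
Proof.
have := is_derive1_comp (is_derive_expR (- z)) (is_deriveNid z (1:R)).
by rewrite mulrN1.
Qed.

Lemma is_derive_Ein z : 0 < z -> is_derive z 1 Ein ((1 - expR (- z)) / z).
Proof.
move=> z0.
have dL : is_derive z 1 ln_expRN_integral (ln z * expR (- z)).
  (* The fundamental theorem needs integrability up to a point beyond z. *)
  have zz : z < z + 1 by rewrite ltrDl.
  have [||dF F'] := continuous_FTC1 zz (integrable_ln_expR (z + 1)).
  - by [].
  - apply: cvgM; first exact: continuous_ln.
    apply: continuous_comp; [exact: opp_continuous | exact: continuous_expR].
  by split => //; rewrite -derive1E.
have dl := is_derive1_ln z0.
have dE := is_derive_expRN z.
have -> : Ein = (cst 1 - (fun y => expR (- y))) * @ln R - ln_expRN_integral.
  by [].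
apply: is_derive_eq; rewrite /GRing.scale /= !fctE.
by field; rewrite gt_eqF.
Qed.

Lemma integral_expRN z : 0 < z ->
  \int[mu]_(t in `]0, z]) expR (- t) = 1 - expR (- z).
Proof.
move=> z0; rewrite Rintegral_itv_obnd_cbnd; last exact: integrable_expRN.
have dF t : is_derive t 1 (fun y => - expR (- y)) (expR (- t)).
  have dE := is_derive_expRN t.
  have -> : (fun y => - expR (- y)) = - (fun y => expR (- y)) by [].
  by apply: is_derive_eq; rewrite opprK.
have cE : continuous (fun y => expR (- y)).
  move=> t; apply: continuous_comp; last exact: continuous_expR.
  exact: opp_continuous.
have cF : continuous (fun y => - expR (- y)).
  move=> t; apply: differentiable_continuous; apply/derivable1_diffP.
  by case: (dF t).
rewrite /Rintegral (@continuous_FTC2 _ _ (fun y => - expR (- y)) _ _ z0).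
- by rewrite /= oppr0 expR0 opprK addrC.
- exact: continuous_subspaceT.
- split => [t _||].
  + by case: (dF t).
  + exact/cvg_at_right_filter/cF.
  + exact/cvg_at_left_filter/cF.
- by move=> t _; rewrite derive1E; case: (dF t).
Qed.

(** [Ein z] is the integral of [e^-t (ln z - ln t)] over ]0, z]. *)
Lemma Ein_ge0 z : 0 < z -> 0 <= Ein z.
Proof.
move=> z0; rewrite /Ein subr_ge0 mulrC -integral_expRN//.
have intE := integrable_expRN z.
rewrite -RintegralZl//; apply: le_Rintegral => //.
- exact: integrable_ln_expR.
- exact: (integrableZl _ _ intE).
- move=> t; rewrite /= in_itv /= => /andP[t0 tz].
  by rewrite ler_wpM2r ?expR_ge0// ler_ln.
Qed.

(** * The bound *)

(** The difference [D] of the two sides increases strictly, since its derivative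
has the sign of [y - (zeta y + k.+1 * q y)].  Its limit at 0 need not be
computed: [D y >= - y] suffices. *)
Lemma lt_Ein_ln_tail_ratio k x : 0 < x ->
  x < ln (tail_ratio k.+1 x) + k.+1%:R * Ein (ln (tail_ratio k.+1 x)).
Proof.
pose zeta y : R := ln (tail_ratio k.+1 y).
pose D y : R := zeta y + k.+1%:R * Ein (zeta y) - y.
pose q y : R := 1 - (tail_ratio k.+1 y)^-1.
have zeta0 y : 0 < y -> 0 < zeta y.
  by move=> y0; apply: ln_gt0; exact: tail_ratio_gt1.
have expNz y : 0 < y -> 1 - expR (- zeta y) = q y.
  move=> y0; rewrite expRN lnK// posrE.
  exact: lt_trans ltr01 (tail_ratio_gt1 _ y0).
have q0 y : 0 < y -> 0 < q y.
  by move=> y0; rewrite -expNz// subr_gt0 expR_lt1 oppr_lt0 zeta0.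
pose dD y : R := k.+1%:R * q y * (y - (zeta y + k.+1%:R * q y)) / (y * zeta y).
have dDP y : 0 < y -> is_derive y 1 D (dD y).
  move=> y0; have dz := is_derive_ln_tail_ratio k y0.
  have dE := is_derive1_comp (is_derive_Ein (zeta0 _ y0)) dz.
  have -> : D = zeta + k.+1%:R \*: (Ein \o zeta) - id by [].
  apply: is_derive_eq; rewrite /GRing.scale /= expNz// -/(q y) /dD.
  by field; rewrite !gt_eqF// zeta0.
have dD0 y : 0 < y -> 0 < dD y.
  move=> y0; rewrite divr_gt0 ?mulr_gt0 ?q0 ?zeta0 ?ltr0n//.
  by rewrite subr_gt0; exact: ln_tail_ratio_lt.
have Dlt y t : 0 < y -> y < t -> D y < D t.
  move=> y0 yt; have [|u /andP[yu _] e] := @is_derive_mean D dD y t yt.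
    by move=> u /andP[yu _]; apply: dDP; exact: lt_le_trans yu.
  by rewrite -subr_gt0 e mulr_gt0 ?subr_gt0// dD0// (lt_trans y0).
have Dge y : 0 < y -> - y <= D y.
  move=> y0; rewrite lerDr addr_ge0 ?mulr_ge0 ?ler0n//.
    by rewrite ltW ?zeta0.
  by rewrite Ein_ge0 ?zeta0.
move=> x0; rewrite -subr_gt0 -/(D x).
have x2 : 0 < x / 2 by rewrite divr_gt0.
(* Only [0 <= D (x / 2)] follows from [D y >= - y]; going from x / 2 to x
   makes the inequality strict. *)
apply: (@le_lt_trans _ _ (D (x / 2))); last by apply: Dlt => //; lra.
apply/ler_addgt0Pl => e e0.
set d := Num.min e (x / 4).
have d0 : 0 < d by rewrite lt_min e0 divr_gt0.
have : D d < D (x / 2) by rewrite Dlt// /d gt_min; apply/orP; right; lra.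
have := Dge d d0; have : d <= e by rewrite /d ge_min lexx.
lra.
Qed.

End exponential_tails_and_incomplete_gamma.

Theorem proposition8 (R : realType) (n : nat) (delta : R)
    (hdelta : 0 < delta < n.+1%:R) :
  let z := ln (n.+1%:R / delta) in
  s_n n delta < z + (n.+1%:R - delta) * ln z - n.+1%:R * dgamma_inc 1 z.
Proof.
cbv zeta; set z := ln (n.+1%:R / delta).
have [s0 se] := s_nP hdelta; have /andP[d0 dn] := hdelta.
have ratioE : tail_ratio n.+1 (s_n n delta) = n.+1%:R / delta.
  apply: (canLR (mulfK _)); first by rewrite gt_eqF ?monomial_gt0.
  rewrite /exp_tail se addrC addKr mulrAC monomialS.
  by rewrite /monomial exprS; ring.
have := lt_Ein_ln_tail_ratio n s0; rewrite ratioE -/z.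
have eN : n.+1%:R * (1 - expR (- z)) = n.+1%:R - delta.
  rewrite expRN lnK ?posrE ?divr_gt0//; field.
  by rewrite !gt_eqF.
by rewrite /Ein dgamma_inc1E -eN; congr (_ < _); ring.
Qed.
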